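(* Let $1 \leq k < n$ and let $\Lambda_k \subset \mathbb{R}^n$ be an orthogonal lattice of rank $k$. There exists an orthogonal lattice $\Lambda_{k+1} \subset \mathbb{R}^n$ of rank $k+1$ so that $\Lambda_k \subset \Lambda_{k+1}$, $\Lambda_{k+1}$ is an extension of $\Lambda_k$, and $\mu(\Lambda_{k+1}) = \mu(\Lambda_k)$. Further, if $z$ is a deep hole of $\Lambda_k$, then $z$ is also a deep hole of $\Lambda_{k+1}$.
   Context: A lattice of rank $m$ in $\mathbb{R}^n$ is $\Lambda = A\mathbb{Z}^m$ for a real $n \times m$ matrix $A$ of rank $m$. A lattice is orthogonal if it has a basis consisting of pairwise orthogonal vectors. If $L \subset \Lambda$ is a sublattice of smaller rank, $\Lambda$ is an extension of $L$ if $\Lambda \cap \operatorname{span}_{\mathbb{R}} L = L$. The covering radius is $\mu(\Lambda) = \min\{ r \in \mathbb{R} : \Lambda + B(r) = \operatorname{span}_{\mathbb{R}}\Lambda \}$, where $B(r)$ is the closed ball of radius $r$ centered at the origin in $\operatorname{span}_{\mathbb{R}}\Lambda$. A vector $z \in \operatorname{span}_{\mathbb{R}}\Lambda$ is a deep hole of $\Lambda$ if $d(z,\Lambda) = \max\{ d(y,\Lambda) : y \in \operatorname{span}_{\mathbb{R}}\Lambda \}$, where $d(y,\Lambda) = \min\{\|x - y\| : x \in \Lambda\}$. *)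

(* Defs.v *)
From HB Require Import structures.
From mathcomp Require Import all_boot all_order all_algebra.
From mathcomp Require Import boolp classical_sets reals.

Set Implicit Arguments.
Unset Strict Implicit.
Unset Printing Implicit Defensive.

Import Order.TTheory GRing.Theory Num.Theory.
Local Open Scope classical_set_scope.
Local Open Scope ring_scope.

Definition is_min (R : realType) (S : set R) (m : R) : Prop :=
  S m /\ lbound S m.

Definition is_max (R : realType) (S : set R) (m : R) : Prop :=
  S m /\ ubound S m.

(* The value is meaningful when the minimum is attained; it is 0 otherwise.
   In [dist] and [covering_radius] below the minimum is attained as soon as
   the argument is a lattice. *)
Definition minimum (R : realType) (S : set R) : R := xget 0 (is_min S).

Lemma is_min_minimum (R : realType) (S : set R) (m : R) :
  is_min S m -> minimum S = m.
Proof.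
move=> [Sm lem]; rewrite /minimum; case: xgetP => [x _ [Sx lex]|/(_ m)].
  by apply/eqP; rewrite eq_le lem // lex.
by case.
Qed.

(* The norm provided by MathComp-Analysis on matrices is the sup norm, so the
   Euclidean structure is spelled out. *)
Definition dotv (R : realType) (n : nat) (u v : 'cV[R]_n) : R :=
  \sum_(i < n) u i 0 * v i 0.

Definition enorm (R : realType) (n : nat) (v : 'cV[R]_n) : R :=
  Num.sqrt (dotv v v).

Definition rspan (R : realType) (n : nat) (S : set 'cV[R]_n) : set 'cV[R]_n :=
  [set v | exists2 s : seq 'cV[R]_n, [set` s] `<=` S & v \in <<s>>%VS].

(* The columns of [A] form a basis of the lattice [L] = A Z^m. *)
Definition lattice_basis (R : realType) (n m : nat)
    (L : set 'cV[R]_n) (A : 'M[R]_(n, m)) : Prop :=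
  \rank A = m /\
  L = [set A *m map_mx (fun a : int => a%:~R) z | z in [set: 'cV[int]_m]].

Definition lattice (R : realType) (n m : nat) (L : set 'cV[R]_n) : Prop :=
  exists A : 'M[R]_(n, m), lattice_basis L A.

Definition orthogonal_lattice (R : realType) (n m : nat)
    (L : set 'cV[R]_n) : Prop :=
  exists2 A : 'M[R]_(n, m), lattice_basis L A &
    forall i j : 'I_m, i != j -> dotv (col i A) (col j A) = 0.

Definition lattice_extension (R : realType) (n : nat)
    (L' L : set 'cV[R]_n) : Prop :=
  exists l m : nat,
    [/\ (l < m)%N, lattice l L, lattice m L',
        L `<=` L' & L' `&` rspan L = L].

Definition span_ball (R : realType) (n : nat) (L : set 'cV[R]_n) (r : R) :
    set 'cV[R]_n :=
  [set v | rspan L v /\ enorm v <= r].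

Definition covering_radius (R : realType) (n : nat) (L : set 'cV[R]_n) : R :=
  minimum [set r : R |
    [set x + b | x in L & b in span_ball L r] = rspan L].

Definition dist (R : realType) (n : nat) (y : 'cV[R]_n) (L : set 'cV[R]_n) : R :=
  minimum [set enorm (x - y) | x in L].

Definition deep_hole (R : realType) (n : nat) (L : set 'cV[R]_n)
    (z : 'cV[R]_n) : Prop :=
  rspan L z /\ is_max [set dist y L | y in rspan L] (dist z L).

(* Main.v *)
Require Import Defs.
From HB Require Import structures.
From mathcomp Require Import all_boot all_order all_algebra.
From mathcomp Require Import boolp classical_sets reals.
From mathcomp Require Import ring lra.

(** Write an orthogonal lattice as L = A Z^m with pairwise orthogonal columns.
    In the coordinates given by A the squared Euclidean norm is a weighted sum
    of squares, so a nearest lattice point is found by rounding each coordinate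
    separately, and every rounding error is at most 1/2. Hence no point of the
    span is farther from L than the half diagonal h = (a_1 + ... + a_m) / 2,
    and a point at that distance has all its coordinates in 1/2 + Z. This gives
    two facts: the covering radius of L is |h|
    ([covering_radius_orthogonal]), and the deep holes of L are exactly the
    points of h + L ([deep_hole_orthogonal]).

    It is therefore enough to enlarge L to an orthogonal lattice of rank one
    more that has the same half diagonal. As the rank of L is less than n,
    there is a vector c orthogonal to L with |c| = |a_1|
    ([exists_normal_vector]). Replace the basis vector a_1 by the two vectors
    (a_1 + c) / 2 and (a_1 - c) / 2 ([split_column]): they are the sides of the
    square with diagonals a_1 and c, so they are orthogonal to each other, and
    both are orthogonal to a_2, ..., a_k. Their sum is a_1, so the half diagonal
    does not change and the new lattice L' contains L. A point of L' in the
    span of L is orthogonal to c, which forces its first two coordinates to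
    agree ([split_column_mul_span]); thus it is in L, and L' extends L. Finally
    a deep hole of L is in h + L, hence in h + L', so it is a deep hole
    of L'. *)

Set Implicit Arguments.
Unset Strict Implicit.
Unset Printing Implicit Defensive.

Import Order.TTheory GRing.Theory Num.Theory.
Local Open Scope classical_set_scope.
Local Open Scope ring_scope.

(** * The Euclidean inner product *)

Lemma dotvE (R : realType) (n : nat) (u v : 'cV[R]_n) :
  dotv u v = (u^T *m v) 0 0.
Proof. by rewrite mxE; apply: eq_bigr => i _; rewrite mxE. Qed.

Lemma dotvC (R : realType) (n : nat) (u v : 'cV[R]_n) : dotv u v = dotv v u.
Proof. by apply: eq_bigr => i _; rewrite mulrC. Qed.

Lemma dotvDl (R : realType) (n : nat) (u v w : 'cV[R]_n) :
  dotv (u + v) w = dotv u w + dotv v w.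
Proof. by rewrite !dotvE linearD mulmxDl mxE. Qed.

Lemma dotvZl (R : realType) (n : nat) (a : R) (u v : 'cV[R]_n) :
  dotv (a *: u) v = a * dotv u v.
Proof. by rewrite !dotvE linearZ /= -scalemxAl mxE. Qed.

Lemma dotvBl (R : realType) (n : nat) (u v w : 'cV[R]_n) :
  dotv (u - v) w = dotv u w - dotv v w.
Proof. by rewrite dotvDl -scaleN1r dotvZl mulN1r. Qed.

Lemma dotvv_ge0 (R : realType) (n : nat) (v : 'cV[R]_n) : 0 <= dotv v v.
Proof. by apply: sumr_ge0 => i _; rewrite -expr2 sqr_ge0. Qed.

Lemma dotvv_gt0 (R : realType) (n : nat) (v : 'cV[R]_n) :
  v != 0 -> 0 < dotv v v.
Proof.
move=> v0; rewrite lt_def dotvv_ge0 andbT; apply: contra v0 => /eqP v0.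
apply/eqP/colP => i; rewrite mxE.
have /(_ i isT)/eqP := psumr_eq0P (fun i _ => sqr_ge0 (v i 0)) v0.
by rewrite mulf_eq0 orbb => /eqP.
Qed.

Lemma le_enorm (R : realType) (n : nat) (u v : 'cV[R]_n) :
  (enorm u <= enorm v) = (dotv u u <= dotv v v).
Proof. by rewrite /enorm ler_sqrt ?dotvv_ge0. Qed.

Lemma enormN (R : realType) (n : nat) (v : 'cV[R]_n) : enorm (- v) = enorm v.
Proof.
by congr Num.sqrt; apply: eq_bigr => i _; rewrite mxE mulrNN.
Qed.

(** * Matrices with pairwise orthogonal columns *)

Definition orthogonal_columns (R : realType) (n m : nat) (A : 'M[R]_(n, m)) :=
  forall i j : 'I_m, i != j -> dotv (col i A) (col j A) = 0.

(** Pythagoras: the Gram matrix of A is diagonal. All the estimates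
    below are made coordinate by coordinate thanks to this formula. *)
Lemma dotv_mulmx_orthogonal (R : realType) (n m : nat) (A : 'M[R]_(n, m))
    (t : 'cV[R]_m) :
    orthogonal_columns A ->
  dotv (A *m t) (A *m t) =
    \sum_(i < m) t i 0 ^+ 2 * dotv (col i A) (col i A).
Proof.
move=> oA; have gramE i j : (A^T *m A) i j = dotv (col i A) (col j A).
  by rewrite mxE; apply: eq_bigr => l _; rewrite !mxE.
rewrite dotvE trmx_mul -mulmxA mxE; apply: eq_bigr => i _.
rewrite mulmxA mxE [X in _ * X]mxE (bigD1 i) //= big1 => [|j ji].
  by rewrite addr0 gramE; ring.
by rewrite gramE oA ?mul0r // eq_sym.
Qed.

Lemma mulmx_full_inj (R : realType) (n m : nat) (A : 'M[R]_(n, m))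
    (t : 'cV[R]_m) :
  \rank A = m -> A *m t = 0 -> t = 0.
Proof.
move=> rA At0; apply: trmx_inj; rewrite trmx0.
have fA : row_free A^T by rewrite /row_free mxrank_tr rA.
by apply: (row_free_inj fA); rewrite mul0mx -trmx_mul At0 trmx0.
Qed.

Lemma col_sqnorm_gt0 (R : realType) (n m : nat) (A : 'M[R]_(n, m)) (i : 'I_m) :
  \rank A = m -> 0 < dotv (col i A) (col i A).
Proof.
move=> rA; apply: dotvv_gt0; apply/eqP; rewrite colE => /(mulmx_full_inj rA).
by move/matrixP/(_ i 0)/eqP; rewrite !mxE !eqxx oner_eq0.
Qed.

Lemma orthogonal_rank (R : realType) (n m : nat) (A : 'M[R]_(n, m)) :
    orthogonal_columns A ->
    (forall i : 'I_m, 0 < dotv (col i A) (col i A)) ->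
  \rank A = m.
Proof.
move=> oA pA; rewrite -mxrank_tr; apply/eqP; rewrite -/(row_free A^T).
rewrite -kermx_eq0; apply/rowV0P => v /sub_kermxP vA.
have Av : A *m v^T = 0 by rewrite -[A]trmxK -trmx_mul vA trmx0.
have := dotv_mulmx_orthogonal v^T oA; rewrite Av => /esym.
rewrite [RHS]big1 => [|i _]; last by rewrite mxE mul0r.
move/psumr_eq0P => v0; apply/rowP => i; rewrite mxE.
have /eqP := v0 (fun j _ => mulr_ge0 (sqr_ge0 _) (ltW (pA j))) i isT.
by rewrite mulf_eq0 (gt_eqF (pA i)) orbF sqrf_eq0 mxE => /eqP.
Qed.

(** The span is defined through finite families of lattice points; this
    parametrization by real coordinates is what the computations use. *)
Lemma rspan_lattice (R : realType) (n m : nat) (L : set 'cV[R]_n)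
    (A : 'M[R]_(n, m)) :
  lattice_basis L A -> rspan L = [set A *m t | t in [set: 'cV[R]_m]].
Proof.
move=> [_ LE]; apply/seteqP; split=> [v [s sL vs]|_ [t _ <-]].
  suff /memv_imgP[t _ ->] : v \in limg (linfun (mulmx A : 'cV_m -> 'cV_n)).
    by exists t => //; rewrite lfunE.
  apply: subvP vs; apply/span_subvP => u /sL; rewrite LE => -[z _ <-].
  by rewrite -(lfunE (mulmx A : 'cV_m -> 'cV_n)) memv_img ?memvf.
exists [seq col i A | i <- enum 'I_m].
  move=> _ /mapP[i _ ->]; rewrite LE; exists (delta_mx i 0) => //.
  by rewrite map_delta_mx colE.
have -> : A *m t = \sum_(i < m) t i 0 *: col i A.
  apply/colP => j; rewrite mxE summxE; apply: eq_bigr => i _.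
  by rewrite !mxE mulrC.
apply: rpred_sum => i _; apply: rpredZ.
by apply/memv_span/mapP; exists i; rewrite ?mem_enum.
Qed.

(** * Rounding coordinates to the nearest integer *)

Definition nearest_int (R : realType) (x : R) : int := Num.floor (x + 2^-1).

(** Ties are rounded up, so the error may be -1/2 but never 1/2: an error of
    absolute value 1/2 has a known sign. *)
Lemma nearest_int_itv (R : realType) (x : R) :
  - 2^-1 <= x - (nearest_int x)%:~R < 2^-1.
Proof.
have := floor_le_tmp (x + 2^-1); have := floorD1_gt (x + 2^-1).
by rewrite intrD -/(nearest_int x); lra.
Qed.

Lemma nearest_int_half (R : realType) (x : R) :
  (x - (nearest_int x)%:~R) ^+ 2 <= 2^-1 ^+ 2.
Proof. by have := nearest_int_itv x; nra. Qed.

Lemma nearest_int_min (R : realType) (x : R) (z : int) :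
  (x - (nearest_int x)%:~R) ^+ 2 <= (z%:~R - x) ^+ 2.
Proof.
have := nearest_int_itv x.
set p := nearest_int x => /andP[lo hi].
have [->|zp] := eqVneq z p; first by rewrite -sqrrN opprB.
have [zltp|pltz|/eqP] := ltgtP z p; last by rewrite (negPf zp).
- have : (z + 1)%:~R <= p%:~R :> R by rewrite ler_int lezD1.
  by rewrite intrD; nra.
- have : (p + 1)%:~R <= z%:~R :> R by rewrite ler_int lezD1.
  by rewrite intrD; nra.
Qed.

Definition nearest_col (R : realType) (m : nat) (t : 'cV[R]_m) : 'cV[int]_m :=
  map_mx (@nearest_int R) t.

Definition frac_col (R : realType) (m : nat) (t : 'cV[R]_m) : 'cV[R]_m :=
  t - map_mx intr (nearest_col t).

Definition half_diagonal (R : realType) (n m : nat) (A : 'M[R]_(n, m)) :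
  'cV[R]_n := A *m const_mx 2^-1.

(** * Distance, covering radius and deep holes of an orthogonal lattice *)

(** By Pythagoras the squared distance from A t to A z is a sum of terms each
    depending on one coordinate of z, so rounding every coordinate of t
    minimizes all the terms at once. *)
Lemma dist_is_min (R : realType) (n m : nat) (L : set 'cV[R]_n)
    (A : 'M[R]_(n, m)) (t : 'cV[R]_m) :
    lattice_basis L A ->
    orthogonal_columns A ->
  is_min [set enorm (x - A *m t) | x in L] (enorm (A *m frac_col t)).
Proof.
move=> [rA LE] oA; split.
  exists (A *m map_mx intr (nearest_col t)).
    by rewrite LE; exists (nearest_col t).
  by rewrite -mulmxBr -enormN -mulmxN opprB.
move=> _ [x Lx <-]; move: Lx; rewrite LE => -[z _ <-].
rewrite -mulmxBr le_enorm !dotv_mulmx_orthogonal //; apply: ler_sum => i _.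
by rewrite ler_wpM2r ?dotvv_ge0 // !mxE nearest_int_min.
Qed.

Lemma dist_lattice (R : realType) (n m : nat) (L : set 'cV[R]_n)
    (A : 'M[R]_(n, m)) (t : 'cV[R]_m) :
    lattice_basis L A ->
    orthogonal_columns A ->
  dist (A *m t) L = enorm (A *m frac_col t).
Proof. by move=> LA oA; apply/is_min_minimum/dist_is_min. Qed.

Lemma frac_col_le (R : realType) (n m : nat) (A : 'M[R]_(n, m))
    (t : 'cV[R]_m) :
    orthogonal_columns A ->
  enorm (A *m frac_col t) <= enorm (half_diagonal A).
Proof.
move=> oA; rewrite le_enorm !dotv_mulmx_orthogonal //; apply: ler_sum => i _.
by rewrite ler_wpM2r ?dotvv_ge0 // !mxE nearest_int_half.
Qed.

Lemma frac_col_half_int (R : realType) (m : nat) (z : 'cV[int]_m) :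
  frac_col (const_mx 2^-1 + map_mx intr z : 'cV[R]_m) = - const_mx 2^-1.
Proof.
apply/colP => i; rewrite !mxE /nearest_int.
have -> : 2^-1 + (z i 0)%:~R + 2^-1 = (1 + z i 0)%:~R :> R.
  by rewrite intrD; lra.
by rewrite intrKfloor intrD; lra.
Qed.

Lemma dist_half_diagonal (R : realType) (n m : nat) (L : set 'cV[R]_n)
    (A : 'M[R]_(n, m)) (x : 'cV[R]_n) :
    lattice_basis L A ->
    orthogonal_columns A ->
    L x ->
  dist (half_diagonal A + x) L = enorm (half_diagonal A).
Proof.
move=> LA oA; rewrite {1}(proj2 LA) => -[z _ <-].
by rewrite -mulmxDr (dist_lattice _ LA oA) frac_col_half_int mulmxN enormN.
Qed.

Lemma lattice_basis0 (R : realType) (n m : nat) (L : set 'cV[R]_n)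
    (A : 'M[R]_(n, m)) : lattice_basis L A -> L 0.
Proof. by move=> [_ ->]; exists 0 => //; rewrite map_mx0 mulmx0. Qed.

(** Rounding shows that balls of radius |h| cover the span, where h is the half
    diagonal; h itself is at distance |h| from the lattice, so that no smaller
    radius suffices. *)
Lemma covering_radius_orthogonal (R : realType) (n m : nat) (L : set 'cV[R]_n)
    (A : 'M[R]_(n, m)) :
    lattice_basis L A ->
    orthogonal_columns A ->
  covering_radius L = enorm (half_diagonal A).
Proof.
move=> LA oA; have [rA LE] := LA; have spanE := rspan_lattice LA.
apply: is_min_minimum; split.
  apply/seteqP; split=> [_ [x Lx [b [+ _] <-]]|].
    move: Lx; rewrite spanE LE => -[z _ <-] [t _ <-].
    by exists (map_mx intr z + t); rewrite ?mulmxDr.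
  rewrite spanE => _ [t _ <-].
  exists (A *m map_mx intr (nearest_col t)).
    by rewrite LE; exists (nearest_col t).
  exists (A *m frac_col t); last by rewrite -mulmxDr addrC subrK.
  by split; [rewrite spanE; exists (frac_col t)|exact: frac_col_le].
move=> r /seteqP[_ /(_ (half_diagonal A))]; rewrite {1}spanE.
case=> [|x Lx [b [_ br] xbE]]; first by exists (const_mx 2^-1).
rewrite -(dist_half_diagonal LA oA (lattice_basis0 LA)) addr0.
apply: le_trans br; rewrite (dist_lattice _ LA oA).
have [_] := dist_is_min (const_mx 2^-1) LA oA; apply.
by exists x => //; rewrite -/(half_diagonal A) -xbE opprD addNKr enormN.
Qed.

(** The largest possible distance |h| is reached only if every coordinate has
    rounding error 1/2 in absolute value, because all the columns of A are
    nonzero: each coordinate then counts with a positive weight. *)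
Lemma deep_hole_orthogonal (R : realType) (n m : nat) (L : set 'cV[R]_n)
    (A : 'M[R]_(n, m)) (y : 'cV[R]_n) :
    lattice_basis L A ->
    orthogonal_columns A ->
  deep_hole L y <-> exists2 x, L x & y = half_diagonal A + x.
Proof.
move=> LA oA; have [rA LE] := LA; have spanE := rspan_lattice LA.
split=> [[+ [_ ub]]|[x Lx ->]]; last first.
  have hxL : rspan L (half_diagonal A + x).
    move: Lx; rewrite spanE LE => -[z _ <-].
    by exists (const_mx 2^-1 + map_mx intr z); rewrite ?mulmxDr.
  split=> //; split; first by exists (half_diagonal A + x).
  rewrite (dist_half_diagonal LA oA Lx) => _ [v + <-].
  by rewrite spanE => -[t _ <-]; rewrite (dist_lattice _ LA oA) frac_col_le.
rewrite spanE => -[t _ yE].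
have hmax : enorm (half_diagonal A) <= enorm (A *m frac_col t).
  rewrite -(dist_lattice t LA oA) yE.
  apply: ub; exists (half_diagonal A).
    by rewrite spanE; exists (const_mx 2^-1).
  have L0 := lattice_basis0 LA.
  by rewrite -[half_diagonal A]addr0 (dist_half_diagonal LA) ?addr0.
have fracE i : frac_col t i 0 = - 2^-1.
  have term_ge0 j : true -> 0 <= (2^-1 ^+ 2 - frac_col t j 0 ^+ 2)
      * dotv (col j A) (col j A).
    move=> _; rewrite mulr_ge0 ?dotvv_ge0 // subr_ge0 !mxE.
    exact: nearest_int_half.
  (* This sum is |h|^2 - d(y, L)^2, which is zero as y is a deep hole. *)
  have sum0 : \sum_(i < m) (2^-1 ^+ 2 - frac_col t i 0 ^+ 2)
      * dotv (col i A) (col i A) = 0.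
    apply/eqP; rewrite eq_le sumr_ge0 // andbT.
    move: hmax; rewrite le_enorm !dotv_mulmx_orthogonal // -subr_le0 -sumrB.
    by congr (_ <= _); apply: eq_bigr => j _; rewrite mulrBl mxE.
  have /(_ i isT)/eqP := psumr_eq0P term_ge0 sum0.
  rewrite mulf_eq0 (gt_eqF (col_sqnorm_gt0 i rA)) orbF => /eqP.
  by have := nearest_int_itv (t i 0); rewrite !mxE; nra.
(* The rounding errors are -1/2, so t = nearest_col t - 1/2, which is
   1/2 + (nearest_col t - 1). *)
exists (A *m map_mx intr (nearest_col t - const_mx 1)).
  by rewrite LE; exists (nearest_col t - const_mx 1).
rewrite -yE -mulmxDr; congr (_ *m _); apply/colP => i.
by have := fracE i; rewrite !mxE intrB; lra.
Qed.

(** * Splitting a basis vector into two orthogonal halves *)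

Lemma exists_normal_vector (R : realType) (n m : nat) (A : 'M[R]_(n, m))
    (d : R) : (m < n)%N -> 0 < d ->
  exists2 c : 'cV[R]_n, A^T *m c = 0 & dotv c c = d.
Proof.
move=> mn d0.
have /rowV0Pn[u /sub_kermxP uA u0] : kermx A != 0.
  rewrite kermx_eq0 /row_free neq_ltn.
  by rewrite (leq_ltn_trans (rank_leq_col A) mn).
have q0 : 0 < dotv u^T u^T by rewrite dotvv_gt0 // trmx_eq0.
exists (Num.sqrt (d / dotv u^T u^T) *: u^T).
  by rewrite -scalemxAr -trmx_mul uA trmx0 scaler0.
rewrite dotvZl dotvC dotvZl mulrA.
by rewrite -expr2 sqr_sqrtr ?divr_ge0 ?ltW // divfK ?gt_eqF.
Qed.

(** If a is the first column of A, the columns (a + c) / 2 and (a - c) / 2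
    replace it. When c is orthogonal to a and has the same length, they are two
    adjacent sides of a square with diagonals a and c. *)
Definition split_column (R : realType) (n k : nat) (A : 'M[R]_(n, 1 + k))
    (c : 'cV[R]_n) : 'M[R]_(n, 1 + (1 + k)) :=
  row_mx (2^-1 *: (lsubmx A + c)) (row_mx (2^-1 *: (lsubmx A - c)) (rsubmx A)).

(** The coordinates of a point change in this way when [split_column] replaces
    the basis, because the two new vectors add up to the one they replace. *)
Definition dup_coord (T : Type) (k : nat) (t : 'cV[T]_(1 + k)) :
  'cV[T]_(1 + (1 + k)) := col_mx (usubmx t) t.

Lemma mul_split_column_dup (R : realType) (n k : nat) (A : 'M[R]_(n, 1 + k))
    (c : 'cV[R]_n) (t : 'cV[R]_(1 + k)) :
  split_column A c *m dup_coord t = A *m t.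
Proof.
rewrite -[in RHS](hsubmxK A) -[t in RHS]vsubmxK.
rewrite -[X in dup_coord X]vsubmxK /dup_coord col_mxKu !mul_row_col.
rewrite addrA -mulmxDl; congr (_ *m _ + _).
by apply/matrixP => i j; rewrite !mxE; lra.
Qed.

(** The half diagonal has equal coordinates, and duplicating the first of them
    yields again a vector of equal coordinates. *)
Lemma split_column_half_diagonal (R : realType) (n k : nat)
    (A : 'M[R]_(n, 1 + k)) (c : 'cV[R]_n) :
  half_diagonal (split_column A c) = half_diagonal A.
Proof.
rewrite /half_diagonal -(mul_split_column_dup A c); congr (_ *m _).
by apply/colP => i; rewrite !mxE; case: split => j; rewrite !mxE.
Qed.


Lemma orthogonal_columns_row_mx (R : realType) (n m : nat) (u : 'cV[R]_n)
    (A : 'M[R]_(n, m)) :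
    (forall j : 'I_m, dotv u (col j A) = 0) -> orthogonal_columns A ->
  orthogonal_columns (row_mx u A).
Proof.
move=> uA oA i j.
have col_u (l : 'I_1) : col l u = u by rewrite [l]ord1 col_id.
case: (split_ordP i) => i' ->; case: (split_ordP j) => j' -> ij;
  rewrite ?colKl ?colKr ?col_u //.
- by move: ij; rewrite [i']ord1 [j']ord1 eqxx.
- by rewrite dotvC.
- by apply: oA; apply: contra ij => /eqP ->.
Qed.

Lemma lsubmx_col (R : realType) (n k : nat) (A : 'M[R]_(n, 1 + k)) :
  lsubmx A = col (lshift k 0) A.
Proof. by apply/colP => i; rewrite !mxE. Qed.

Lemma col_rsubmx1 (R : realType) (n k : nat) (A : 'M[R]_(n, 1 + k))
    (j : 'I_k) :
  col j (rsubmx A) = col (rshift 1 j) A.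
Proof. by apply/colP => i; rewrite !mxE. Qed.

Lemma normal_col (R : realType) (n m : nat) (A : 'M[R]_(n, m)) (c : 'cV[R]_n)
    (j : 'I_m) :
  A^T *m c = 0 -> dotv c (col j A) = 0.
Proof. by move=> cA; rewrite dotvC dotvE tr_col -row_mul cA mxE mxE. Qed.

(** The inner product of (a + c) / 2 and (a - c) / 2 is (|a|^2 - |c|^2) / 4. *)
Lemma split_column_orthogonal (R : realType) (n k : nat)
    (A : 'M[R]_(n, 1 + k)) (c : 'cV[R]_n) :
  orthogonal_columns A -> A^T *m c = 0 ->
  dotv c c = dotv (lsubmx A) (lsubmx A) ->
  orthogonal_columns (split_column A c).
Proof.
move=> oA cA cc.
have aA j : dotv (lsubmx A) (col j (rsubmx A)) = 0
  by rewrite lsubmx_col col_rsubmx1 oA.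
have cR j : dotv c (col j (rsubmx A)) = 0 by rewrite col_rsubmx1 normal_col.
have ca : dotv c (lsubmx A) = 0 by rewrite lsubmx_col normal_col.
apply: orthogonal_columns_row_mx => [j|].
  case: (split_ordP j) => j' ->; rewrite ?colKl ?colKr.
    rewrite [j']ord1 col_id dotvZl dotvC dotvZl dotvBl ![dotv _ (_ + c)]dotvC.
    by rewrite !dotvDl ca [dotv _ c]dotvC ca cc; ring.
  by rewrite dotvZl dotvDl aA cR; ring.
apply: orthogonal_columns_row_mx => [j|i j ij].
  by rewrite dotvZl dotvBl aA cR; ring.
by rewrite !col_rsubmx1 oA //; apply: contra ij => /eqP/rshift_inj ->.
Qed.

Lemma map_dup_coord (T S : Type) (f : T -> S) (k : nat) (t : 'cV[T]_(1 + k)) :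
  map_mx f (dup_coord t) = dup_coord (map_mx f t).
Proof. by rewrite /dup_coord map_col_mx map_usubmx. Qed.

Lemma split_column_rank (R : realType) (n k : nat) (A : 'M[R]_(n, 1 + k))
    (c : 'cV[R]_n) :
    orthogonal_columns A -> \rank A = (1 + k)%N -> A^T *m c = 0 ->
    dotv c c = dotv (lsubmx A) (lsubmx A) ->
  \rank (split_column A c) = (1 + (1 + k))%N.
Proof.
move=> oA rA cA cc; apply: orthogonal_rank => [|i].
  exact: split_column_orthogonal.
have ca : dotv c (lsubmx A) = 0 by rewrite lsubmx_col normal_col.
have a_gt0 : 0 < dotv (lsubmx A) (lsubmx A)
  by rewrite lsubmx_col col_sqnorm_gt0.
case: (split_ordP i) => i' ->; rewrite ?colKl ?colKr.
  rewrite [i']ord1 col_id dotvZl dotvC dotvZl dotvDl ![dotv _ (_ + c)]dotvC.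
  by rewrite !dotvDl ca [dotv _ c]dotvC ca cc; lra.
case: (split_ordP i') => j ->; rewrite ?colKl ?colKr.
  rewrite [j]ord1 col_id dotvZl dotvC dotvZl dotvBl ![dotv _ (_ - c)]dotvC.
  by rewrite !dotvBl ca [dotv _ c]dotvC ca cc; lra.
rewrite col_rsubmx1; exact: col_sqnorm_gt0.
Qed.

(** Taking inner products with c: the columns of A are orthogonal to c, and the
    two new columns have opposite inner products |c|^2 / 2 and - |c|^2 / 2
    with it. So a combination of the new columns that lies in the span of A has
    equal coordinates on these two. *)
Lemma split_column_mul_span (R : realType) (n k : nat) (A : 'M[R]_(n, 1 + k))
    (c : 'cV[R]_n) (t : 'cV[R]_(1 + k)) (s : 'cV[R]_(1 + (1 + k))) :
    A^T *m c = 0 -> c != 0 ->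
    split_column A c *m s = A *m t ->
  usubmx s = usubmx (dsubmx s).
Proof.
move=> cA c0 sE; have cA' : c^T *m A = 0.
  by rewrite -[A]trmxK -trmx_mul cA trmx0.
have := cA'; rewrite -{1}[A]hsubmxK mul_mx_row -[0]hsubmxK => /eq_row_mx[].
rewrite !linear0 => cl cr.
have : c^T *m (split_column A c *m s) = 0 by rewrite sE mulmxA cA' mul0mx.
rewrite -{1}[s]vsubmxK -{1}[dsubmx s]vsubmxK !mul_row_col !mulmxDr !mulmxA cr.
rewrite -!scalemxAr mulmxDr mulmxBr cl mul0mx addr0 add0r sub0r.
rewrite scalerN mulNmx -mulmxBr => /matrixP/(_ 0 0).
rewrite mxE big_ord1 !mxE -/(dotv _ _) => /eqP.
have := dotvv_gt0 c0; rewrite dotvE mxE => cc.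
rewrite !mulf_eq0 invr_eq0 pnatr_eq0 (gt_eqF cc) /= subr_eq0 => /eqP e.
by apply/colP => i; rewrite [i]ord1 !mxE.
Qed.

Theorem theorem1p4 (R : realType) (n k : nat) (k_ge1 : (1 <= k)%N)
    (k_lt_n : (k < n)%N) (L : set 'cV[R]_n) (oL : orthogonal_lattice k L) :
  exists L' : set 'cV[R]_n,
    [/\ orthogonal_lattice k.+1 L', L `<=` L', lattice_extension L' L,
        covering_radius L' = covering_radius L &
        forall z : 'cV[R]_n, deep_hole L z -> deep_hole L' z].
Proof.
(* The first basis vector is the one to be split, so k must be a successor. *)
case: k k_ge1 k_lt_n oL => [//|k] _ k_lt_n [A LA oA].
have [rA LE] := LA.
pose a := lsubmx (A : 'M_(n, 1 + k)).
have aE : a = col 0 A.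
  by apply/colP => i; rewrite !mxE; congr (A i _); apply/val_inj.
have a_gt0 : 0 < dotv a a by rewrite aE col_sqnorm_gt0.
have [c cA cc] := exists_normal_vector (A : 'M_(n, 1 + k)) k_lt_n a_gt0.
have c0 : c != 0.
  by apply: contraTneq a_gt0 => c0; rewrite -cc c0 dotvE mulmx0 mxE ltxx.
pose A' := split_column (A : 'M_(n, 1 + k)) c.
have oA' : orthogonal_columns A' by apply: split_column_orthogonal.
have rA' : \rank A' = (1 + (1 + k))%N by apply: split_column_rank.
pose L' := [set A' *m map_mx intr z | z in [set: 'cV[int]_(1 + (1 + k))]].
have LA' : lattice_basis L' A' by split.
have subL : L `<=` L'.
  rewrite LE => _ [z _ <-]; exists (dup_coord (z : 'cV_(1 + k))) => //.
  by rewrite map_dup_coord mul_split_column_dup.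
have hE : half_diagonal A' = half_diagonal A.
  exact: split_column_half_diagonal.
exists L'; split=> //.
- by exists A'.
- exists k.+1, k.+2; split=> //; [by exists A|by exists A'|].
  apply/seteqP; split=> [x [[z _ <-]]|x Lx]; last first.
    split; first exact: subL.
    move: Lx; rewrite (rspan_lattice LA) LE => -[z _ <-].
    by exists (map_mx intr z).
  rewrite (rspan_lattice LA) => -[t _ /esym sE].
  have := split_column_mul_span cA c0 sE.
  rewrite -map_dsubmx -!map_usubmx => zzR.
  have zz : usubmx z = usubmx (dsubmx z).
    apply/matrixP => i j; move/matrixP/(_ i j): zzR.
    by rewrite !mxE => /intr_inj.
  rewrite LE; exists (dsubmx z) => //.
  rewrite -(mul_split_column_dup (A : 'M_(n, 1 + k)) c) -map_dup_coord.
  by rewrite /dup_coord -zz vsubmxK.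
- rewrite (covering_radius_orthogonal LA oA).
  by rewrite (covering_radius_orthogonal LA' oA') hE.
move=> y /(deep_hole_orthogonal _ LA oA)[x Lx yE].
by apply/(deep_hole_orthogonal _ LA' oA'); exists x; [exact: subL|rewrite hE].
Qed.
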